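(* Let $\mathbb{P}$ denote the set of prime numbers. The function $g$ maps the non-negative integers into $\mathbb{N}_{\geq 0} \setminus \mathbb{P}$ and is surjective onto $\mathbb{N}_{\geq 0} \setminus \mathbb{P}$, i.e. every non-negative integer that is not prime equals $g(n)$ for some non-negative integer $n$.
   Context: For a non-negative integer $n$, $g(n)$ is the least integer $k$ such that there exists a strictly increasing sequence of integers $n = a_1 < a_2 < \cdots < a_t = k$ ($t \geq 1$) whose product $a_1 a_2 \cdots a_t$ is a perfect square. *)

(* Defs.v *)
From mathcomp Require Import all_boot.
From mathcomp Require Import boolp.

Set Implicit Arguments.
Unset Strict Implicit.
Unset Printing Implicit Defensive.

Definition perfect_square (m : nat) : Prop := exists r : nat, m = r ^ 2.

(* The sequence a_1 < ... < a_t is written n :: s, so that t = (size s).+1 >= 1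
   and a_1 = n; its terms are nonnegative because a_1 is, so it lives in nat. *)
Definition square_chain (n k : nat) : Prop :=
  exists s : seq nat,
    [/\ path ltn n s, last n s = k & perfect_square (\prod_(a <- n :: s) a)].

(* The sequence n < 4n, or the single term 0 when n = 0. *)
Lemma square_chain_ex (n : nat) : exists k, `[< square_chain n k >].
Proof.
case: n => [|n].
  exists 0; apply/asboolP; exists [::]; split=> //.
  by exists 0; rewrite big_seq1.
exists (4 * n.+1); apply/asboolP; exists [:: 4 * n.+1]; split=> //=.
  by rewrite andbT ltn_Pmull.
exists (2 * n.+1).
by rewrite big_cons big_seq1 mulnCA mulnn expnMn.
Qed.

Definition g (n : nat) : nat := ex_minn (square_chain_ex n).

Lemma gP (n : nat) :
  square_chain n (g n) /\ (forall k, square_chain n k -> g n <= k).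
Proof.
rewrite /g; case: ex_minnP => m /asboolP nm min_m; split=> // k nk.
by apply: min_m; apply/asboolP.
Qed.

(* Main.v *)
Require Import Defs.
From mathcomp Require Import all_boot.
From mathcomp Require Import boolp.

(** Given a composite [m], let [n] be the largest possible first term of a
    sequence ending at [m] with square product.  If some sequence from [n] to
    [k < m] also had square product, the symmetric difference of the two
    sequences would still have square product and end at [m], but would start
    beyond [n]; hence [g n = m].  Conversely no sequence of positive integers
    ends at a prime [p], since [p] would divide the product exactly once. *)

Lemma path_ltn_bounds (n : nat) (s : seq nat) :
  path ltn n s -> {in n :: s, forall x, n <= x <= last n s}.
Proof.
elim: s n => [|y s IHs] n /=; first by move=> _ x; rewrite inE => /eqP->; rewrite leqnn.
case/andP=> lt_ny /IHs bnd x; rewrite inE => /predU1P[->|/bnd /andP[le_yx ->]].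
  by have /andP[_ le_yl] := bnd y (mem_head y s); rewrite leqnn (leq_trans (ltnW lt_ny)).
by rewrite (leq_trans (ltnW lt_ny) le_yx).
Qed.

(** If [x * y ^ 2 = z ^ 2], then [y] divides [z], and the quotient is a root of [x]. *)
Lemma perfect_square_mulr (x y : nat) :
  0 < y -> perfect_square (x * y ^ 2) -> perfect_square x.
Proof.
move=> y_gt0 [z def_z].
have /dvdnP[q def_q]: y %| z by rewrite -(@dvdn_pexp2r _ _ 2) // -def_z dvdn_mull.
exists q; apply/eqP; rewrite -(@eqn_pmul2r (y ^ 2)) ?expn_gt0 ?y_gt0 //.
by rewrite def_z def_q expnMn.
Qed.

(** Sorting [u] gives the chain. Membership in [u] is all that is kept about its start, so that
    bounds on the start can be read off from the elements of [u]. *)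
Lemma square_chain_of_uniq (u : seq nat) (k : nat) :
    uniq u -> k \in u -> {in u, forall x, x <= k} ->
    perfect_square (\prod_(a <- u) a) ->
  exists2 n, n \in u & square_chain n k.
Proof.
move=> uniq_u uk le_k sq_u.
have mem_v := mem_sort leq u; have perm_v := permEl (perm_sort leq u).
have: sorted ltn (sort leq u).
  by rewrite ltn_sorted_uniq_leq sort_uniq uniq_u (sort_sorted leq_total).
case def_v: (sort leq u) mem_v perm_v => [|n s] mem_v perm_v.
  by have := mem_v k; rewrite uk.
move=> /= path_s; exists n; first by rewrite -mem_v mem_head.
exists s; split=> //; last by rewrite (perm_big _ perm_v).
apply/eqP; rewrite eqn_leq le_k; last by rewrite -mem_v mem_last.
by have /andP[] := path_ltn_bounds _ _ path_s k (etrans (mem_v k) uk).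
Qed.

(** The two products multiply to the product over the symmetric difference times the square of the
    product over the common terms. Positivity of [s] makes that square nonzero, so it cancels. *)
Lemma perfect_square_symdiff (s t : seq nat) :
    uniq s -> uniq t -> {in s, forall x, 0 < x} ->
    perfect_square (\prod_(a <- s) a) -> perfect_square (\prod_(a <- t) a) ->
  perfect_square (\prod_(a <- [seq x <- s | x \notin t]
                           ++ [seq x <- t | x \notin s]) a).
Proof.
move=> uniq_s uniq_t s_gt0 [p def_p] [q def_q].
apply: (@perfect_square_mulr _ (\prod_(a <- s | a \in t) a)).
  by rewrite big_seq_cond; apply: prodn_cond_gt0 => i /andP[/s_gt0].
have capC: \prod_(a <- t | a \in s) a = \prod_(a <- s | a \in t) a.
  rewrite -big_filter -[RHS]big_filter; apply/perm_big/uniq_perm.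
  - exact: filter_uniq.
  - exact: filter_uniq.
  - by move=> x; rewrite !mem_filter andbC.
exists (p * q); rewrite expnMn -def_p -def_q.
rewrite big_cat /= !big_filter.
rewrite [in RHS](bigID (mem t) (r := s) predT) [in RHS](bigID (mem s) (r := t) predT) /= capC.
by rewrite -mulnn [RHS]mulnACA mulnC.
Qed.

(** If [m = e * d] with [d] and [e] distinct proper divisors, then [d], [e], [m] have product
    [m ^ 2]; if [d = e] or [m = 1], then [m] alone is a square. *)
Lemma square_chain_exists (m : nat) :
  0 < m -> ~~ prime m -> exists2 n, 0 < n & square_chain n m.
Proof.
move=> m_gt0 m_composite.
have of_square r : m = r ^ 2 -> exists2 n, 0 < n & square_chain n m.
  by move=> def_m; exists m => //; exists [::]; split=> //; exists r; rewrite big_seq1.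
have [m_le1|[d /andP[d_gt1 lt_dm] /dvdnP[e def_m]]] := primePn m_composite.
  by apply: (of_square 1); apply/eqP; rewrite eqn_leq -ltnS m_le1.
have e_gt1: 1 < e.
  rewrite ltnNge; apply: contraL lt_dm => e_le1.
  by rewrite -leqNgt def_m -{2}(mul1n d) leq_mul2r e_le1 orbT.
have [def_d|ne_de] := eqVneq d e; first by apply: (of_square d); rewrite def_m -def_d mulnn.
have lt_em: e < m by rewrite def_m ltn_Pmulr // ltnW.
have [||x||n] := @square_chain_of_uniq [:: d; e; m] m.
- by rewrite /= !inE negb_or ne_de (ltn_eqF lt_dm) (ltn_eqF lt_em).
- by rewrite !inE eqxx !orbT.
- by rewrite !inE => /or3P[] /eqP-> //; apply: ltnW.
- by exists m; rewrite !big_cons big_nil muln1 mulnA (mulnC d) -def_m mulnn.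
rewrite !inE => mem_n chain_n; exists n => //.
by case/or3P: mem_n => /eqP-> //; apply: ltnW.
Qed.

Lemma square_chain_start_gt (n k m : nat) :
    0 < n -> k < m -> square_chain n k -> square_chain n m ->
  exists2 n', n < n' & square_chain n' m.
Proof.
move=> n_gt0 lt_km [t [path_t last_t sq_t]] [s [path_s last_s sq_s]].
have bnd_t := path_ltn_bounds _ _ path_t; have bnd_s := path_ltn_bounds _ _ path_s.
have uniq_path r : path ltn n r -> uniq (n :: r).
  exact: (@sorted_uniq _ ltn ltn_trans ltnn (n :: r)).
have uniq_t := uniq_path t path_t; have uniq_s := uniq_path s path_s.
have s_gt0: {in n :: s, forall x, 0 < x}.
  by move=> x /bnd_s /andP[/(leq_trans n_gt0)].
have sq_u := perfect_square_symdiff _ _ uniq_s uniq_t s_gt0 sq_s sq_t.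
have [|||n' mem_n' chain_n'] := square_chain_of_uniq _ m _ _ _ sq_u.
- rewrite cat_uniq !filter_uniq // andbT andTb; apply/hasPn => x.
  by rewrite !mem_filter => /andP[/negPf-> _]; rewrite andbF.
(* [m] survives: the chain [n :: t] stops at [k < m], so it does not contain [m]. *)
- rewrite mem_cat mem_filter -{2}last_s mem_last andbT; apply/orP; left.
  by apply: contraL lt_km => /bnd_t /andP[_]; rewrite last_t -leqNgt.
- move=> x; rewrite mem_cat !mem_filter => /orP[] /andP[_].
    by case/bnd_s/andP=> _; rewrite last_s.
  by case/bnd_t/andP=> _; rewrite last_t => /leq_trans; apply; apply: ltnW.
exists n' => //; rewrite ltn_neqAle; apply/andP; split.
  (* Both chains start at [n], which therefore drops out of the symmetric difference. *)
  apply: contraTneq mem_n' => <-.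
  by rewrite mem_cat !mem_filter !mem_head.
by move: mem_n'; rewrite mem_cat !mem_filter => /orP[] /andP[_] => [/bnd_s|/bnd_t] /andP[].
Qed.

Lemma square_chain_prime (n p : nat) : 0 < n -> prime p -> ~ square_chain n p.
Proof.
move=> n_gt0 p_prime [s [path_s last_s [r def_r]]].
have p_gt0 := prime_gt0 p_prime.
have bnd_s := path_ltn_bounds _ _ path_s.
have uniq_s: uniq (n :: s) := @sorted_uniq _ ltn ltn_trans ltnn (n :: s) path_s.
have mem_p: p \in n :: s by rewrite -last_s mem_last.
have rem_bnd x : x \in rem p (n :: s) -> 0 < x < p.
  rewrite mem_rem_uniq // inE => /andP[ne_xp /bnd_s /andP[le_nx le_xp]].
  by rewrite (leq_trans n_gt0 le_nx) ltn_neqAle ne_xp -{1}last_s.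
(* The terms other than [p] lie strictly between 0 and [p]. *)
have rem_coprime: coprime p (\prod_(a <- rem p (n :: s)) a).
  rewrite big_seq; elim/big_ind: _ => [|x y cpx cpy|x /rem_bnd /andP[x_gt0 lt_xp]].
  - exact: coprimen1.
  - by rewrite coprimeMr cpx.
  - by rewrite prime_coprime // gtnNdvd.
(* The [p]-adic valuation is 1 on the left and even on the right. *)
have := congr1 (logn p) def_r; rewrite (perm_big _ (perm_to_rem mem_p)) big_cons.
rewrite lognM //; last by rewrite big_seq; apply: prodn_cond_gt0 => x /rem_bnd /andP[].
rewrite (logn_coprime rem_coprime) logn_prime // eqxx lognX addn0.
by move/(congr1 odd); rewrite oddM.
Qed.

Theorem theorem1p13 :
  (forall n : nat, ~~ prime (g n)) /\
  (forall m : nat, ~~ prime m -> exists n : nat, g n = m).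
Proof.
have g0: g 0 = 0.
  apply/eqP; rewrite -leqn0; have [_ ->] := gP 0 => //.
  by exists [::]; split=> //; exists 0; rewrite big_seq1.
split=> [[|n]|m m_composite]; first by rewrite g0.
  apply/negP => p_prime; have [chain_g _] := gP n.+1.
  exact: square_chain_prime _ _ (ltn0Sn n) p_prime chain_g.
case: (posnP m) => [->|m_gt0]; first by exists 0.
have [n0 n0_gt0 chain_n0] := square_chain_exists m m_gt0 m_composite.
have ex_n: exists n, `[< square_chain n m >] by exists n0; apply/asboolP.
have le_n n : `[< square_chain n m >] -> n <= m.
  move=> /asboolP[s [path_s <- _]].
  by have /andP[] := path_ltn_bounds _ _ path_s n (mem_head n s).
case: (ex_maxnP ex_n le_n) => n /asboolP chain_n max_n; exists n.
(* A chain from 0 to [m] also exists, with product 0, so positivity of the largest start has to come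
   from the positive start [n0]. *)
have n_gt0: 0 < n by apply: leq_trans n0_gt0 (max_n n0 _); apply/asboolP.
have [chain_g min_g] := gP n.
apply/eqP; rewrite eqn_leq min_g //= leqNgt; apply/negP => lt_gm.
have [n' lt_nn' chain_n'] := square_chain_start_gt _ _ _ n_gt0 lt_gm chain_g chain_n.
by move: lt_nn'; rewrite ltnNge max_n //; apply/asboolP.
Qed.
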